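(* Let $p\ge 5$ be a prime. Then $$\sum_{k=0}^{p-1}(2k+1)^3\frac{T_k^4}{9^k}\equiv-\frac{3p}{4}+\frac{3p^2}{4}\left(\frac{q_p(3)}{4}-1\right)\pmod{p^3}.$$
   Context: $T_k$ denotes the $k$th central trinomial coefficient, i.e. the coefficient of $x^k$ in the expansion of $(x^2+x+1)^k$. For an integer $a$ not divisible by $p$, $q_p(a):=(a^{p-1}-1)/p$ is the Fermat quotient. For rational numbers $u,v$, $u\equiv v\pmod{p^m}$ means that $u-v\in p^m\mathbb{Z}_{(p)}$, where $\mathbb{Z}_{(p)}$ is the ring of rationals with denominator not divisible by $p$. *)

(* Defs.v *)
From mathcomp Require Import all_boot all_order all_algebra.

Set Implicit Arguments.
Unset Strict Implicit.
Unset Printing Implicit Defensive.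

Import Order.TTheory GRing.Theory Num.Theory.
Local Open Scope ring_scope.

Definition central_trinomial (k : nat) : int :=
  (('X^2 + 'X + 1 : {poly int}) ^+ k)`_k.

(* A rational number, not the truncated quotient in [int]. *)
Definition fermat_quotient (p : nat) (a : int) : rat :=
  (a%:~R ^+ p.-1 - 1) / p%:R.

(* The localization of the integers at the prime ideal (p); [denq x] is the
   denominator of [x] in lowest terms. *)
Definition Zloc (p : nat) : pred rat := fun x => ~~ (p%:Z %| denq x)%Z.

(* u - v lies in p ^ m Z_(p). *)
Definition congr_ppow (p m : nat) (u v : rat) : Prop :=
  exists2 w : rat, w \in Zloc p & u - v = p%:R ^+ m * w.

(* Main.v *)
Require Import Defs.
From mathcomp Require Import all_boot all_order all_algebra ring zify.

Import Order.TTheory GRing.Theory Num.Theory.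
Local Open Scope ring_scope.

(** Write T_k for the central trinomial coefficients and
    u_j(k) = 'C(k, j) 'C(k + j, j), the coefficients of the shifted Legendre
    polynomials ([legendre_coef]).  The proof compares the sum with the same
    sum in which the weight (2k+1)^3 is replaced by 2k+1, and evaluates the
    latter by expanding the squares T_k^2.

    - A combination of the two telescopes: (2k+1)^3 T_k^4 / 9^k plus
      (3/4) (2k+1) T_k^4 / 9^k is the difference of an explicit quartic form in
      T_k and T_(k-1) ([central_trinomial_quartic_telescope]).  At k = p this
      form is -(27/4) p^2 (T_p T_(p-1))^2 / 9^p modulo p^3, and the squares of
      T_p and T_(p-1) are 1 modulo p, so the boundary contributes -3 p^2 / 4.

    - T_k is the k-th power of sqrt(-3) times the value of the Legendre
      polynomial P_k at 1/sqrt(-3).  The square of P_k has an expansion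
      of Clausen type, which here reads
      T_k^2 = (-3)^k sum_j 'C(2j, j) (-1/3)^j u_j(k)
      ([central_trinomial_sqr]).

    - Hence the sum S of (2k+1) T_k^4 / 9^k over k < p is a double sum whose
      coefficients are products of central binomials and whose terms are the
      moments sum_(k < p) (2k+1) u_i(k) u_j(k).  Modulo p^3 such a moment only
      depends on i + j: it is p 'C(p, i + j + 1), at least when i + j < p; when
      i + j >= p this holds modulo p^2 only, but then one of the two central
      binomials is divisible by p ([legendre_moment_mod],
      [sum_odd_clausen_sum_sqr_mod]).

    - On the antidiagonal i + j = s the products of central binomials add up to
      4^s, so the binomial theorem evaluates what remains:
      4 S = p (1 + 3^p) / 3^(p-1) modulo p^3 ([clausen_coef_bin_sum]).

    The sum to be computed is therefore -3 p^2 / 4 - (3/4) S, and substituting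
    3^(p-1) = 1 + p q, where q is the Fermat quotient, gives the claim.  The
    congruences are proved in the integers, after clearing the powers of 2 and 3
    from the denominators. *)

(** * The recurrence of the central trinomial coefficients *)

Lemma coef_trinomial_expS (n j : nat) (A := 'X^2 + 'X + 1 : {poly int}) :
  (A ^+ n.+1)`_j.+1 = (A ^+ n)`_j.+1 + (A ^+ n)`_j
    + (if j is i.+1 then (A ^+ n)`_i else 0).
Proof.
rewrite exprS {1}/A !mulrDl mul1r !coefD coefXnM coefXM /=.
by case: j => [|j] /=; rewrite ?subn2 /=; ring.
Qed.

Lemma coef_trinomial_deriv (n j : nat) (A := 'X^2 + 'X + 1 : {poly int}) :
  (A ^+ n.+1)`_j.+1 *+ j.+1 =
    ((A ^+ n)`_j + (if j is i.+1 then (A ^+ n)`_i else 0) *+ 2) *+ n.+1.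
Proof.
have <- : (A ^+ n.+1)^`()`_j = (A ^+ n.+1)`_j.+1 *+ j.+1 by rewrite coef_deriv.
rewrite deriv_exp /= coefMn; congr (_ *+ _).
rewrite {1}/A !derivE addr0 mul1r mulr1 -mulr2n mulrDl mul1r coefD addrC.
by congr (_ + _); rewrite mulrnAl coefMn coefXM; case: j.
Qed.

Lemma central_trinomial0 : central_trinomial 0 = 1.
Proof. by rewrite /central_trinomial expr0 coef1. Qed.

Lemma central_trinomial1 : central_trinomial 1 = 1.
Proof. by rewrite /central_trinomial expr1 !coefE. Qed.

(** Let t_n and s_n be the coefficients of X^n and X^(n-1) in the n-th power.
    Expanding the power and differentiating it give two relations between
    consecutive rows; eliminating all other coefficients leaves a first-order
    system in (t_n, s_n), which is equivalent to the recurrence. *)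
Lemma central_trinomial_rec (k : nat) :
  k.+2%:R * central_trinomial k.+2 =
    (2 * k%:R + 3) * central_trinomial k.+1
    + 3 * k.+1%:R * central_trinomial k.
Proof.
rewrite /central_trinomial; set A := 'X^2 + 'X + 1.
pose t n := (A ^+ n)`_n; pose s n := if n is m.+1 then (A ^+ n)`_m else 0.
have tS n : t n.+1 = t n + 2 * s n.
  have/mulfI : n.+1%:R != 0 :> int by rewrite pnatr_eq0.
  by apply; rewrite !mulr_natl (coef_trinomial_deriv n n).
have sS n : n.+2%:R * s n.+1 = n.+1%:R * (2 * t n + s n).
  case: n => [|n]; first by rewrite /t /s expr0 expr1 !coefE.
  have := coef_trinomial_expS n.+1 n; have := coef_trinomial_deriv n.+1 n.
  rewrite -/A /= -/(t n.+1).
  set c := (if n is _.+1 then _ else _) => E1 E2.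
  have {}E2 : c = (A ^+ n.+2)`_n.+1 - t n.+1 - (A ^+ n.+1)`_n.
    by rewrite E2; ring.
  move: E1; rewrite E2 -[_ *+ n.+1]mulr_natl -[_ *+ n.+2]mulr_natl => E1.
  have -> : n.+3%:R * (A ^+ n.+2)`_n.+1
      = 2 * n.+2%:R * (A ^+ n.+2)`_n.+1 - n.+1%:R * (A ^+ n.+2)`_n.+1 :> int.
    by rewrite -!natr1; ring.
  by rewrite E1; ring.
have := sS k; rewrite -/(t k) -/(t k.+1) -/(t k.+2) (tS k.+1) tS.
by move: (s k.+1) (s k) (t k) => a b c; rewrite -!natr1; lia.
Qed.

(** * Shifted Legendre coefficients *)

(** Up to sign, the coefficient of x^j in the shifted Legendre polynomial
    P_k(1 - 2 x).  As a function of k it is a polynomial in k (k + 1), of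
    degree j. *)
Definition legendre_coef (k j : nat) : int := ('C(k, j) * 'C(k + j, j))%N%:Z.

Lemma legendre_coef0 (k : nat) : legendre_coef k 0 = 1.
Proof. by rewrite /legendre_coef !bin0. Qed.

Lemma legendre_coef_small (k j : nat) : (k < j)%N -> legendre_coef k j = 0.
Proof. by move=> ltkj; rewrite /legendre_coef bin_small. Qed.

Lemma legendre_coef_recr (k j : nat) :
  j.+1%:R ^+ 2 * legendre_coef k j.+1 =
    (k%:R - j%:R) * (k%:R + 1 + j%:R) * legendre_coef k j.
Proof.
have [lejk|ltkj] := leqP j k; last first.
  by rewrite (legendre_coef_small _ _ ltkj) (legendre_coef_small k j.+1 (leqW ltkj))
    !mulr0.
have E1 := mul_bin_left k j; have E2 := mul_bin_diag (k + j.+1) j.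
rewrite addnS /= in E2.
rewrite /legendre_coef addnS !natz; move: E1 E2 lejk.
move: 'C(k, j.+1) 'C((k + j).+1, j.+1) 'C(k, j) 'C(k + j, j) => a b c d.
move=> E1 E2 lejk.
have -> : (j.+1%:Z ^+ 2 * (a * b)%N = (j.+1 * a)%N%:Z * (j.+1 * b)%N%:Z) by lia.
rewrite E1 -E2 !PoszM -subzn // -addn1 !PoszD; ring.
Qed.

Lemma legendre_coef_recl (k j : nat) :
  (k%:R + 1 - j%:R) * legendre_coef k.+1 j =
    (k%:R + 1 + j%:R) * legendre_coef k j.
Proof.
have [lejk|ltkj] := leqP j k.+1; last first.
  by rewrite (legendre_coef_small _ _ ltkj) (legendre_coef_small k j (ltnW ltkj))
    !mulr0.
have E1 := mul_bin_down k.+1 j; have := mul_bin_down (k + j).+1 j.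
have -> : ((k + j).+1 - j = k.+1)%N by lia.
rewrite /legendre_coef !natz /= addSn => E2; move: E1 E2 lejk => /=.
move: 'C(k.+1, j) 'C((k + j).+1, j) 'C(k, j) 'C(k + j, j) => a b c d.
move=> E1 E2 lejk.
have -> : (k%:Z + 1 - j%:Z) = (k.+1 - j)%N%:Z by lia.
have -> : (k%:Z + 1 + j%:Z) = (k + j).+1%:Z by lia.
rewrite -!PoszM mulnA -E1.
have -> : ((k + j).+1 * (c * d) = c * ((k + j).+1 * d))%N by lia.
by rewrite E2; congr Posz; lia.
Qed.

(** Together with [clausen_coef_rec] this is the termwise form of the recurrence
    for T_k^2 in [clausen_sum_rec].  With j + 1 in place of j and multiplied by
    (j + 1)^2, every term becomes a polynomial multiple of u_j(k+1), so that
    the vanishing of u_j(k) for j > k needs no separate treatment. *)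
Lemma legendre_coef_diff (k j : nat) :
  k.+2%:R ^+ 2 * legendre_coef k.+2 j - k.+1%:R ^+ 2 * legendre_coef k j =
    (2 * k%:R + 3) * ((2 * j%:R + 1) * legendre_coef k.+1 j
      + 2 * j%:R * legendre_coef k.+1 j.-1).
Proof.
case: j => [|j] /=; first by rewrite !legendre_coef0 -!natr1; ring.
have/mulfI : (j.+1%:R ^+ 2 != 0 :> int) by rewrite expf_eq0 pnatr_eq0.
apply; have E1 := legendre_coef_recr k.+2 j; have E2 := legendre_coef_recr k j.
have E3 := legendre_coef_recr k.+1 j.
have E4 := legendre_coef_recl k.+1 j; have E5 := legendre_coef_recl k j.
rewrite mulrBr ![j.+1%:R ^+ 2 * (_ * legendre_coef _ _)]mulrCA E1 E2.
have -> : (k%:R - j%:R) * (k%:R + 1 + j%:R) * legendre_coef k j =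
  (k%:R - j%:R) * ((k%:R + 1 - j%:R) * legendre_coef k.+1 j).
  by rewrite E5; ring.
have -> : (k.+2%:R - j%:R) * (k.+2%:R + 1 + j%:R) * legendre_coef k.+2 j =
  (k.+2%:R + 1 + j%:R) * ((k.+1%:R + 1 + j%:R) * legendre_coef k.+1 j).
  by rewrite -E4 -!natr1; ring.
rewrite [RHS]mulrCA [X in _ = _ * X]mulrDr [X in _ = _ * (X + _)]mulrCA E3.
by rewrite -!natr1; ring.
Qed.

(** * The expansion of the square of a central trinomial coefficient *)

Lemma central_bin_rec (j : nat) :
  (j.+1 * 'C(2 * j.+1, j.+1) = 2 * (2 * j + 1) * 'C(2 * j, j))%N.
Proof.
have E1 := mul_bin_diag (2 * j).+2 j; have E2 := mul_bin_down (2 * j).+1 j.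
have E3 : ((2 * j).+1 - j = j.+1)%N by lia.
rewrite /= E3 in E1 E2; rewrite mulnS -E1.
by apply/eqP; rewrite -(eqn_pmul2l (ltn0Sn j)); apply/eqP; nia.
Qed.

(** The coefficient 'C(2j, j) (-1/3)^j of the expansion of T_k^2 / (-3)^k,
    multiplied by (-3)^N to make it an integer for all j <= N. *)
Definition clausen_coef (N j : nat) : int :=
  'C(2 * j, j)%:R * (- 3) ^+ (N - j).

Lemma clausen_coef_rec (N j : nat) : (j < N)%N ->
  -3 * (j.+1%:R * clausen_coef N j.+1) =
    2 * (2 * j%:R + 1) * clausen_coef N j.
Proof.
move=> ltjN; rewrite /clausen_coef -[(N - j)%N]prednK ?subn_gt0 // -subnS exprS.
have := central_bin_rec j; rewrite !natz.
move: 'C(2 * j.+1, j.+1) 'C(2 * j, j) ((-3) ^+ _) => a b c E.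
have {}E : j.+1%:Z * a%:Z = 2 * (2 * j%:Z + 1) * b%:Z by lia.
transitivity (-3 * c * (j.+1%:Z * a%:Z)); first by ring.
by rewrite E; ring.
Qed.

Definition clausen_sum (N k : nat) : int :=
  \sum_(j < N.+1) clausen_coef N j * legendre_coef k j.

(** Summing [legendre_coef_diff] produces a sum over u_(j-1)(k+1).  A shift of
    the index and [clausen_coef_rec] turn it into a sum over u_j(k+1); the shift
    loses the term j = N, which vanishes because k + 1 < N. *)
Lemma clausen_sum_rec (N k : nat)
    (J := \sum_(j < N.+1) clausen_coef N j * j%:R * legendre_coef k.+1 j) :
  (k.+1 < N)%N ->
  -3 * (k.+2%:R ^+ 2 * clausen_sum N k.+2 - k.+1%:R ^+ 2 * clausen_sum N k) =
    (2 * k%:R + 3) * (2 * J + clausen_sum N k.+1).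
Proof.
move=> ltkN.
pose K := \sum_(j < N.+1) clausen_coef N j * j%:R * legendre_coef k.+1 j.-1.
have E1 : k.+2%:R ^+ 2 * clausen_sum N k.+2 - k.+1%:R ^+ 2 * clausen_sum N k
    = (2 * k%:R + 3) * (2 * J + clausen_sum N k.+1 + 2 * K).
  rewrite /clausen_sum /J /K !mulr_sumr -sumrB -!big_split mulr_sumr /=.
  apply: eq_bigr => j _; have := legendre_coef_diff k j.
  move: (legendre_coef k.+2 j) (legendre_coef k j) => x y E.
  rewrite (_ : _ - _ = clausen_coef N j * (k.+2%:R ^+ 2 * x - k.+1%:R ^+ 2 * y)).
    by rewrite E; ring.
  by ring.
have E2 : -3 * K = 2 * (2 * J + clausen_sum N k.+1).
  rewrite /K /J /clausen_sum big_ord_recl /= mulr0 mul0r add0r.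
  rewrite ![in RHS]big_ord_recr /= (legendre_coef_small _ _ ltkN) !mulr0 !addr0.
  rewrite !mulr_sumr -big_split mulr_sumr /=; apply: eq_bigr => j _.
  have := clausen_coef_rec N j (ltn_ord j); rewrite /bump add1n /=.
  move: (clausen_coef N j.+1) => a E.
  have -> : -3 * (a * j.+1%:R * legendre_coef k.+1 j)
     = -3 * (j.+1%:R * a) * legendre_coef k.+1 j by ring.
  by rewrite E; ring.
rewrite E1 mulrCA; congr (_ * _).
by rewrite mulrDr mulrCA E2; ring.
Qed.

(** Squaring the recurrence of T_k brings in the mixed product T_(k+1) T_k, so
    the induction carries its expansion as well: it is obtained from that of
    T_k^2 by inserting the factor k + 1 + j. *)
Lemma central_trinomial_sqr_aux (N k : nat) : (k < N)%N ->
  [/\ (- 3) ^+ N * central_trinomial k ^+ 2 = (- 3) ^+ k * clausen_sum N k,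
      (- 3) ^+ N * central_trinomial k.+1 ^+ 2 =
        (- 3) ^+ k.+1 * clausen_sum N k.+1
    & (- 3) ^+ N * (k.+1%:R * central_trinomial k.+1 * central_trinomial k) =
        (- 3) ^+ k *
        \sum_(j < N.+1) clausen_coef N j * (k.+1%:R + j%:R) * legendre_coef k j].
Proof.
elim: k => [|k IHk] ltkN.
  case: N ltkN => // N _; rewrite /clausen_sum !big_ord_recl !big1; last 2 first.
  - by move=> i _; rewrite legendre_coef_small ?mulr0.
  - by move=> i _; rewrite legendre_coef_small ?mulr0.
  rewrite central_trinomial0 central_trinomial1.
  rewrite /clausen_coef /legendre_coef /bump /= !subn0 subSS subn0 exprS.
  have -> : bump 0 0 = 1%N by [].
  rewrite !bin0 !bin1 expr0 expr1.
  by split; move: ((-3) ^+ N) => x; ring.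
have [E0 E1 EV] := IHk (ltnW ltkN).
have E2 := clausen_sum_rec N k ltkN; have := central_trinomial_rec k.
move: E2; set J := (X in 2 * X + clausen_sum _ _) => E2.
have EV0 : \sum_(j < N.+1) clausen_coef N j * (k.+1%:R + j%:R) * legendre_coef k j
   = k.+1%:R * clausen_sum N k.+1 - J.
  rewrite /clausen_sum /J mulr_sumr -sumrB; apply: eq_bigr => j _.
  have := legendre_coef_recl k j; rewrite natr1.
  move: (legendre_coef k j) => x E.
  by rewrite -mulrA -E; ring.
have EV1 : \sum_(j < N.+1)
     clausen_coef N j * (k.+2%:R + j%:R) * legendre_coef k.+1 j
   = k.+2%:R * clausen_sum N k.+1 + J.
  rewrite /clausen_sum /J mulr_sumr -big_split; apply: eq_bigr => j _.
  by rewrite /=; ring.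
rewrite EV1; rewrite EV0 in EV; clear EV0 EV1; clearbody J.
move: E0 E1 EV E2; rewrite !(exprS (- 3)).
move: J (clausen_sum N k) (clausen_sum N k.+1) (clausen_sum N k.+2) ((-3) ^+ k).
move: (central_trinomial k) (central_trinomial k.+1) (central_trinomial k.+2).
move: ((-3) ^+ N) => e T0 T1 T2 J S0 S1 S2 q E0 E1 EV E2 ET.
split=> //.
- have nz : k.+2%:R ^+ 2 != 0 :> int by rewrite expf_eq0 pnatr_eq0.
  apply: (mulfI nz); transitivity (e * (k.+2%:R * T2) ^+ 2); first by ring.
  rewrite ET.
  transitivity (-3 * q * (-3 * (k.+2%:R ^+ 2 * S2 - k.+1%:R ^+ 2 * S0)
                          - 3 * (k.+1%:R ^+ 2 * S0))); last by ring.
  rewrite E2.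
  have -> : e * ((2 * k%:R + 3) * T1 + 3 * k.+1%:R * T0) ^+ 2 =
    (2 * k%:R + 3) ^+ 2 * (e * T1 ^+ 2)
    + 6 * (2 * k%:R + 3) * (e * (k.+1%:R * T1 * T0))
    + 9 * k.+1%:R ^+ 2 * (e * T0 ^+ 2) by ring.
  by rewrite E0 E1 EV -!natr1; ring.
- rewrite ET.
  have -> : e * (((2 * k%:R + 3) * T1 + 3 * k.+1%:R * T0) * T1) =
    (2 * k%:R + 3) * (e * T1 ^+ 2) + 3 * (e * (k.+1%:R * T1 * T0)) by ring.
  by rewrite E1 EV -!natr1; ring.
Qed.

Lemma central_trinomial_sqr (N k : nat) : (k <= N)%N ->
  (- 3) ^+ (N - k) * central_trinomial k ^+ 2 = clausen_sum N k.
Proof.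
move=> lekN; have/mulfI : ((- 3) ^+ k != 0 :> int) by rewrite expf_eq0 andbF.
apply; rewrite mulrA -exprD subnKC //.
case: (ltngtP k N) lekN => // [ltkN|->] _.
  by case: (central_trinomial_sqr_aux _ _ ltkN).
case: N => [|N]; last by case: (central_trinomial_sqr_aux _ _ (ltnSn N)).
rewrite /clausen_sum big_ord1 /clausen_coef /legendre_coef.
by rewrite /central_trinomial !expr0 coef1.
Qed.

(** * Moments of the shifted Legendre coefficients *)

Lemma sum_odd_legendre_coef (n s : nat) :
  \sum_(0 <= k < n) (2 * k%:R + 1) * legendre_coef k s =
    n%:R * ('C(n, s.+1)%:R * 'C(n + s, s)%:R) :> int.
Proof.
elim: n => [|n IHn]; first by rewrite big_geq // mul0r.
rewrite big_nat_recr //= IHn.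
have nz : s.+1%:R != 0 :> int by rewrite pnatr_eq0.
apply: (mulfI nz).
have E1 := mul_bin_left n s; have E2 := mul_bin_diag n.+1 s.
have E3 : (n.+1 * 'C((n + s).+1, s) = (n + s).+1 * 'C(n + s, s))%N.
  by rewrite -[in LHS](addnK s n.+1) addSn -mul_bin_down.
rewrite /legendre_coef addSn PoszM; move: E1 E2 E3; rewrite !natz /=.
have [lesn|ltns] := leqP s n; last first.
  rewrite (bin_small ltns) => E1 E2.
  have -> : 'C(n.+1, s.+1) = 0%N by rewrite bin_small.
  by rewrite (bin_small (leqW ltns)); lia.
move: 'C(n, s.+1) 'C(n.+1, s.+1) 'C((n + s).+1, s) 'C(n, s) 'C(n + s, s).
move=> a b c d e E1 E2 E3.
have {}E1 : s.+1%:Z * a%:Z = (n%:Z - s%:Z) * d%:Z by rewrite subzn // -!PoszM E1.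
have {}E2 : s.+1%:Z * b%:Z = n.+1%:Z * d%:Z by rewrite -!PoszM E2.
have {}E3 : n.+1%:Z * c%:Z = (n + s).+1%:Z * e%:Z by rewrite -!PoszM E3.
transitivity (n%:Z * (s.+1%:Z * a%:Z) * e%:Z
    + s.+1%:Z * (2 * n%:Z + 1) * d%:Z * e%:Z); first by ring.
transitivity ((s.+1%:Z * b%:Z) * (n.+1%:Z * c%:Z)); last by ring.
by rewrite E1 E2 E3; lia.
Qed.

Definition legendre_moment (n i j : nat) : int :=
  \sum_(0 <= k < n) (2 * k%:R + 1) * (legendre_coef k i * legendre_coef k j).

(** By [legendre_coef_recr], raising the index i multiplies u_i(k) by
    k (k + 1) - i (i + 1) over (i + 1)^2.  Comparing with the same relation for
    j, the factor k (k + 1) cancels. *)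
Lemma legendre_moment_rec (n i j : nat) :
  i.+1%:R ^+ 2 * legendre_moment n i.+1 j =
    j.+1%:R ^+ 2 * legendre_moment n i j.+1
    + (j%:R - i%:R) * (i + j).+1%:R * legendre_moment n i j.
Proof.
rewrite /legendre_moment !mulr_sumr -big_split; apply: eq_bigr => k _ /=.
have := legendre_coef_recr k i; have := legendre_coef_recr k j.
move: (legendre_coef k i.+1) (legendre_coef k j.+1) => x y Ey Ex.
move: (legendre_coef k i) (legendre_coef k j) Ex Ey => a b Ex Ey.
transitivity ((2 * k%:R + 1) * b * (i.+1%:R ^+ 2 * x)); first by ring.
transitivity ((2 * k%:R + 1) * a * (j.+1%:R ^+ 2 * y)
  + (j%:R - i%:R) * (i + j).+1%:R * ((2 * k%:R + 1) * (a * b))); last by ring.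
by rewrite Ex Ey -!natr1 natrD; ring.
Qed.

Lemma bin_addp_mod (p s : nat) : prime p -> (s < p)%N ->
  (p%:Z %| 'C(p + s, s)%:Z - 1)%Z.
Proof.
move=> p_pr lt_sp; rewrite -binomial.Vandermonde big_ord_recl /=.
rewrite bin0 subn0 binn PoszD addrC addKr.
apply: dvdn_sum => i _; apply/dvdn_mulr/prime_dvd_bin => //.
by rewrite /bump add1n (leq_ltn_trans (ltn_ord i) lt_sp).
Qed.

(** In 'C(2p, p) = sum_i 'C(p, i)^2 all terms but the two extreme ones are
    divisible by p^2. *)
Lemma bin_double_prime_mod (p : nat) : prime p ->
  (p%:Z ^+ 2 %| 'C(2 * p, p)%:Z - 2)%Z.
Proof.
case: p => // p p_pr.
rewrite mul2n -addnn -binomial.Vandermonde big_ord_recl big_ord_recr /=.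
rewrite /bump add1n !bin0 subn0 subnn binn bin0 !PoszD.
have -> x : 1%:Z * 1%:Z + (x + 1%:Z * 1%:Z) - 2 = x by lia.
rewrite expr2 -PoszM; apply: dvdn_sum => i _.
have ltip := ltn_ord i; rewrite /bump add1n.
by apply: dvdn_mul; apply: prime_dvd_bin => //; lia.
Qed.

Lemma bin_double_pred_prime_mod (p : nat) : prime p -> odd p ->
  (p%:Z ^+ 2 %| 'C(p + p.-1, p.-1)%:Z - 1)%Z.
Proof.
move=> p_pr p_odd; have p_gt0 := prime_gt0 p_pr.
have := bin_double_prime_mod p p_pr.
have := mul_bin_diag (2 * p) p.-1; rewrite prednK //.
have -> : ((2 * p).-1 = p + p.-1)%N by lia.
move: 'C(p + p.-1, _) 'C(2 * p, p) => a b E.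
have -> : b = (2 * a)%N.
  by apply/eqP; rewrite -(eqn_pmul2l p_gt0) -E; apply/eqP; lia.
have -> : (2 * a)%N%:Z - 2 = 2 * (a%:Z - 1) by lia.
by rewrite Gauss_dvdzr // coprimezXl // coprimezE /= coprimen2.
Qed.

Lemma legendre_moment0 (n j : nat) :
  legendre_moment n 0 j = n%:Z * ('C(n, j.+1)%:Z * 'C(n + j, j)%:Z).
Proof.
rewrite -!natz -sum_odd_legendre_coef; apply: eq_bigr => k _.
by rewrite legendre_coef0 mul1r.
Qed.

(** For j < p - 1 one factor p comes from 'C(p, j + 1); for j = p - 1 this
    binomial is 1, and the other one has to be known modulo p^2. *)
Lemma legendre_moment0_mod (p j : nat) : prime p -> odd p -> (j < p)%N ->
  (p%:Z ^+ 3 %| legendre_moment p 0 j - p%:Z * 'C(p, j.+1)%:Z)%Z.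
Proof.
move=> p_pr p_odd lt_jp; rewrite legendre_moment0 -mulrBr exprS dvdz_mul //.
move: (lt_jp); rewrite -[X in _ - X]mulr1 -mulrBr leq_eqVlt.
case/predU1P=> [jp|lt_j1p].
  by rewrite dvdz_mull // -jp /= (bin_double_pred_prime_mod j.+1) ?jp.
by rewrite dvdz_mul ?bin_addp_mod //; apply: prime_dvd_bin.
Qed.

(** Induction on i.  In the recurrence that exchanges (i + 1, j) for (i, j + 1)
    the leading factor (i + 1)^2 is prime to p, and p 'C(p, i + j + 1) satisfies
    the same recurrence up to a multiple of p^2 'C(p, i + j + 1).  This error is
    divisible by p^3 below the antidiagonal i + j = p - 1 and by p^2 on it,
    which is why one power of p is lost beyond. *)
Lemma legendre_moment_mod (p i j : nat) : prime p -> odd p -> (i < p)%N ->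
  (p%:Z ^+ (if (i + j < p)%N then 3%N else 2%N) %|
     legendre_moment p i j - p%:Z * 'C(p, (i + j).+1)%:Z)%Z.
Proof.
move=> p_pr p_odd; elim: i j => [|i IHi] j lt_ip /=.
  rewrite add0n; case: ltnP => [lt_jp|le_pj].
    exact: legendre_moment0_mod.
  by rewrite legendre_moment0 bin_small // mul0r mulr0 subr0 dvdz0.
set e := if _ then _ else _.
have co_pi : coprimez (p%:Z ^+ e) (i.+1%:R ^+ 2).
  rewrite coprimezXl // coprimezXr // natz coprimezE /= prime_coprime //.
  by rewrite gtnNdvd.
rewrite -(Gauss_dvdzr _ co_pi) mulrBr legendre_moment_rec.
have := IHi j (ltnW lt_ip); have := IHi j.+1 (ltnW lt_ip).
rewrite addSn addnS -/e.
have E : (i + j).+2%:Z * 'C(p, (i + j).+2)%:Z =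
    (p%:Z - (i + j).+1%:Z) * 'C(p, (i + j).+1)%:Z.
  have [le_sp|lt_ps] := leqP (i + j).+1 p.
    by rewrite subzn // -!PoszM mul_bin_left.
  by rewrite !bin_small ?mulr0 // leqW.
set C2 := 'C(p, (i + j).+2)%:Z in E *; set C1 := 'C(p, (i + j).+1)%:Z in E *.
set M2 := legendre_moment p i j.+1; set M1 := legendre_moment p i j.
move=> D2 D1.
have -> : j.+1%:R ^+ 2 * M2 + (j%:R - i%:R) * (i + j).+1%:R * M1
    - i.+1%:R ^+ 2 * (p%:Z * C2) =
  j.+1%:R ^+ 2 * (M2 - p%:Z * C2)
  + (j%:R - i%:R) * ((i + j).+1%:R * (M1 - p%:Z * C1) + p%:Z * (p%:Z * C1)).
  rewrite !natz; transitivity (j.+1%:Z ^+ 2 * (M2 - p%:Z * C2)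
   + (j%:Z - i%:Z) * ((i + j).+1%:Z * M1) + p%:Z * (j%:Z - i%:Z)
      * ((i + j).+2%:Z * C2)).
    by rewrite -!natz -!natr1 natrD; ring.
  by rewrite E; ring.
apply: rpredD; first by rewrite dvdz_mull.
apply: dvdz_mull.
move: D1; rewrite /e; case: (ltnP (i + j).+1) => [lt_sp|le_ps] D1.
  rewrite (ltnW lt_sp) in D1; apply: rpredD; first exact: dvdz_mull.
  by rewrite !exprS expr0 mulr1 !dvdz_mul //; exact: prime_dvd_bin.
apply: rpredD; last by rewrite mulrA; apply: dvdz_mulr.
by apply: dvdz_mull; apply: dvdz_trans D1; apply: dvdz_exp2l; case: ifP.
Qed.

(** * Summation over the antidiagonals *)

Lemma sum_antidiagonals (R : nmodType) (n : nat) (f : nat -> nat -> R) :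
  (forall i j, (n <= i + j)%N -> f i j = 0) ->
  \sum_(i < n) \sum_(j < n) f i j = \sum_(s < n) \sum_(i < s.+1) f i (s - i)%N.
Proof.
move=> f0; transitivity (\sum_(i < n) \sum_(j < n - i) f i j).
  apply: eq_bigr => i _; rewrite (big_ord_widen n (f i) (leq_subr i n)).
  rewrite [RHS]big_mkcond; apply: eq_bigr => j _.
  by case: ltnP => // le_nij; rewrite f0 // -leq_subLR.
elim: n {f0} => [|n IHn]; first by rewrite !big_ord0.
rewrite [RHS]big_ord_recr -IHn /=.
under eq_bigr => i _ do rewrite subSn -1?ltnS // big_ord_recr.
rewrite big_split /=; congr (_ + _).
by rewrite big_ord_recr /= subnn big_ord0 addr0.
Qed.

(** Let d_s be the sum.  By the symmetry i <-> s - i, weighting its terms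
    by 2 i amounts to multiplying it by s.  Used for s + 1 and for s, together
    with [central_bin_rec], this gives (s + 1) d_(s+1) = 4 (s + 1) d_s. *)
Lemma central_bin_convolution (s : nat) :
  (\sum_(i < s.+1) 'C(2 * i, i) * 'C(2 * (s - i), s - i) = 4 ^ s)%N.
Proof.
pose c i := 'C(2 * i, i); rewrite -/(c _).
elim: s => [|s IHs]; first by rewrite big_ord1.
have sym n (g : nat -> nat) :
    ((\sum_(i < n.+1) i * (g i * g (n - i))) * 2
     = n * \sum_(i < n.+1) g i * g (n - i))%N.
  rewrite muln2 -addnn {1}(reindex_inj rev_ord_inj) -big_split.
  rewrite big_distrr; apply: eq_bigr => i _ /=.
  have lein : (i <= n)%N by rewrite -ltnS.
  by rewrite subSS subKn // [(g (n - i) * _)%N]mulnC -mulnDl subnK.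
apply/eqP; rewrite -(eqn_pmul2l (ltn0Sn s)); apply/eqP.
rewrite -(sym s.+1 c) big_ord_recl mul0n add0n /=.
under eq_bigr => i _.
  rewrite /bump add1n subSS mulnA central_bin_rec -/(c i) -/(c (s - i)%N).
  have -> : (2 * (2 * i + 1) * c i * c (s - i) =
    4 * (i * (c i * c (s - i))) + 2 * (c i * c (s - i)))%N by ring.
  over.
rewrite big_split /= -!big_distrr /=; have := sym s c; move: IHs; rewrite -/c.
move: (\sum_(i < s.+1) i * _)%N (\sum_(i < s.+1) _ * _)%N => a b -> E.
by rewrite expnS; lia.
Qed.

Lemma clausen_coef_antidiagonal (N s : nat) : (s <= N)%N ->
  \sum_(i < s.+1) clausen_coef N i * clausen_coef N (s - i) =
    4 ^+ s * (- 3) ^+ (N - s) * (- 3) ^+ N.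
Proof.
move=> lesN.
transitivity (\sum_(i < s.+1)
    ('C(2 * i, i) * 'C(2 * (s - i), s - i))%N%:R
      * ((- 3) ^+ (N - s) * (- 3) ^+ N) : int).
  apply: eq_bigr => i _; rewrite /clausen_coef mulrACA natrM -!exprD.
  by congr (_ * _ ^+ _); have := ltn_ord i; lia.
by rewrite -mulr_suml -natr_sum central_bin_convolution natrX mulrA.
Qed.

(** After summation over the antidiagonals the left-hand side is, up to a power
    of -3, the expansion of (-3 + 4)^(N+1) without its first term. *)
Lemma clausen_coef_bin_sum (N : nat) :
  4 * \sum_(i < N.+1) \sum_(j < N.+1)
    clausen_coef N i * clausen_coef N j * 'C(N.+1, (i + j).+1)%:R =
  (- 3) ^+ N * (1 - (- 3) ^+ N.+1).
Proof.
rewrite (sum_antidiagonals _ _ (fun i j => clausen_coef N i * clausen_coef N j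
  * 'C(N.+1, (i + j).+1)%:R)); last first.
  by move=> i j leNij; rewrite bin_small ?mulr0 // ltnS.
have -> : 1 - (- 3) ^+ N.+1 = \sum_(s < N.+1)
   4 * (4 ^+ s * (- 3) ^+ (N - s) * 'C(N.+1, s.+1)%:R) :> int.
  have := exprDn (- 3 : int) 4 N.+1; rewrite (_ : (- 3 + 4 = 1 :> int)) //.
  rewrite expr1n big_ord_recl /=.
  rewrite subn0 expr0 mulr1 bin0 => E; rewrite {1}E addrC addKr.
  apply: eq_bigr => s _.
  by rewrite /bump add1n subSS exprS -[X in X = _]mulr_natr; ring.
rewrite !mulr_sumr; apply: eq_bigr => s _.
have -> : \sum_(i < s.+1) clausen_coef N i * clausen_coef N (s - i) *
    'C(N.+1, (i + (s - i)).+1)%:R =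
  (\sum_(i < s.+1) clausen_coef N i * clausen_coef N (s - i)) *
    'C(N.+1, s.+1)%:R.
  rewrite mulr_suml; apply: eq_bigr => i _.
  by rewrite subnKC // -ltnS.
by rewrite clausen_coef_antidiagonal -1?ltnS //; ring.
Qed.

(** * The fourth powers with weight 2k+1 *)

Lemma clausen_coef_dvd (p N i : nat) : prime p -> (i < p)%N -> (p <= 2 * i)%N ->
  (p%:Z %| clausen_coef N i)%Z.
Proof.
move=> p_pr ltip lep2i; rewrite /clausen_coef natz dvdz_mulr //.
have pNfact m : (m < p)%N -> ~~ (p %| m`!)%N.
  elim: m => [|m IHm] ltmp; first by rewrite dvdn1 neq_ltn prime_gt1 ?orbT.
  by rewrite factS Euclid_dvdM // negb_or gtnNdvd // IHm // ltnW.
have E : ('C(2 * i, i) * (i`! * i`!) = (2 * i)`!)%N.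
  by rewrite -(@bin_fact (2 * i) i) ?leq_pmull // mulSn mul1n addnK.
have : (p %| (2 * i)`!)%N by rewrite dvdn_fact // prime_gt0.
by rewrite -E !Euclid_dvdM // (negPf (pNfact i ltip)) !orbF.
Qed.

Lemma sum_odd_clausen_sum_sqr (n N : nat) :
  \sum_(0 <= k < n) (2 * k%:R + 1) * clausen_sum N k ^+ 2 =
  \sum_(i < N.+1) \sum_(j < N.+1)
    clausen_coef N i * clausen_coef N j * legendre_moment n i j.
Proof.
transitivity (\sum_(0 <= k < n) \sum_(i < N.+1) \sum_(j < N.+1)
  clausen_coef N i * clausen_coef N j *
  ((2 * k%:R + 1) * (legendre_coef k i * legendre_coef k j))).
  apply: eq_bigr => k _; rewrite /clausen_sum expr2 mulr_suml mulr_sumr.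
  apply: eq_bigr => i _; rewrite mulr_sumr mulr_sumr.
  by apply: eq_bigr => j _; ring.
rewrite exchange_big; apply: eq_bigr => i _.
rewrite exchange_big; apply: eq_bigr => j _.
by rewrite -mulr_sumr.
Qed.

(** When i + j >= p the moment is only known modulo p^2, but then 2 i >= p or
    2 j >= p and the missing factor p comes from a central binomial. *)
Lemma sum_odd_clausen_sum_sqr_mod (N : nat) (p := N.+1) : prime p -> odd p ->
  (p%:Z ^+ 3 %|
     4 * (\sum_(0 <= k < p) (2 * k%:R + 1) * clausen_sum N k ^+ 2)
     - p%:Z * ((- 3) ^+ N * (1 - (- 3) ^+ p)))%Z.
Proof.
move=> p_pr p_odd; rewrite -clausen_coef_bin_sum mulrCA -mulrBr dvdz_mull //.
rewrite sum_odd_clausen_sum_sqr -/p mulr_sumr -sumrB rpred_sum // => i _.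
rewrite mulr_sumr -sumrB rpred_sum // => j _; rewrite natz.
rewrite [p%:Z * _]mulrCA -mulrBr.
have := legendre_moment_mod p i j p_pr p_odd (ltn_ord i).
case: ltnP => [_|le_pij]; first exact: dvdz_mull.
rewrite exprS; apply: dvdz_mul.
have [le_p2i|lt_2ip] := leqP p (2 * i).
  by rewrite dvdz_mulr // clausen_coef_dvd.
rewrite dvdz_mull // clausen_coef_dvd //.
by rewrite -(leq_add2l (2 * i)) -mulnDr; lia.
Qed.

(** * Reduction of the weight (2k+1)^3 to 2k+1 *)

(** The coefficients on the right solve the linear system that the identity
    imposes on a quartic form in T_(n+1) and T_n with coefficients polynomial
    in n.  The identity is scaled by 32 times 9^n, which makes it integral; in
    terms of X = (n + 2) T_(n+2) the induction step is a polynomial identity. *)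
Lemma central_trinomial_quartic_telescope (n : nat)
    (x := central_trinomial n.+1) (y := central_trinomial n) :
  \sum_(0 <= k < n.+1) (32 * (2 * k%:R + 1) ^+ 3 + 24 * (2 * k%:R + 1))
     * central_trinomial k ^+ 4 * 9 ^+ (n - k) =
  3 * n.+1%:R ^+ 4 * (x ^+ 2 - 2 * x * y - 3 * y ^+ 2) ^+ 2
  + 8 * n.+1%:R ^+ 3 * x * y * (x ^+ 2 + 3 * y ^+ 2)
  - 24 * n.+1%:R ^+ 2 * x ^+ 2 * y ^+ 2.
Proof.
rewrite {}/x {}/y; elim: n => [|n IHn].
  by rewrite big_nat1 subnn central_trinomial0 central_trinomial1; ring.
rewrite big_nat_recr //= subnn.
rewrite (_ : \sum_(0 <= k < n.+1) _ = 9 *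
  (\sum_(0 <= k < n.+1) (32 * (2 * k%:R + 1) ^+ 3 + 24 * (2 * k%:R + 1))
     * central_trinomial k ^+ 4 * 9 ^+ (n - k))); last first.
  rewrite mulr_sumr; apply: eq_big_nat => k /andP[_ lekn].
  by rewrite subSn // (exprS 9) mulrCA.
rewrite IHn expr0 mulr1.
have := central_trinomial_rec n.
move: (central_trinomial n.+2) (central_trinomial n.+1) (central_trinomial n).
move=> z x y E; set X := n.+2%:R * z in E.
transitivity (3 * (X ^+ 2 - 2 * n.+2%:R * X * x - 3 * n.+2%:R ^+ 2 * x ^+ 2) ^+ 2
  + 8 * X * x * (X ^+ 2 + 3 * n.+2%:R ^+ 2 * x ^+ 2)
  - 24 * X ^+ 2 * x ^+ 2); last by rewrite /X; ring.
by rewrite E -!natr1; ring.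
Qed.

(** * Boundary values modulo p *)

Lemma dvdz_fermat (p a : nat) : prime p -> ~~ (p %| a)%N ->
  (p%:Z %| a%:Z ^+ p.-1 - 1)%Z.
Proof.
move=> p_pr pNa; have p_gt0 := prime_gt0 p_pr.
have co_pa : coprimez p a by rewrite coprimezE /= prime_coprime.
rewrite -(Gauss_dvdzr _ co_pa) mulrBr mulr1 -exprS prednK //.
by rewrite -eqz_mod_dvd -natz -natrX !natz !modz_nat fermat_little.
Qed.

Lemma exprN3_even (n : nat) : ~~ odd n -> (- 3 : int) ^+ n = 3 ^+ n.
Proof. by move=> n_even; rewrite exprNn -signr_odd (negPf n_even) mul1r. Qed.

(** In the expansion of T_p^2 only the terms j = 0 and j = p are prime to p.
    They are (-3)^p and 'C(2p, p)^2, which are -3 and 4 modulo p. *)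
Lemma central_trinomial_prime_sqr_mod (p : nat) : prime p -> (3 < p)%N ->
  (p%:Z %| central_trinomial p ^+ 2 - 1)%Z.
Proof.
move=> p_pr p_gt3; have := central_trinomial_sqr p p (leqnn p).
rewrite subnn expr0 mul1r => ->.
have p_odd : odd p by case: (even_prime p_pr) p_gt3 => // ->.
have := dvdz_fermat p 3 p_pr; rewrite gtnNdvd // => /(_ isT) D3.
have := bin_double_prime_mod p p_pr.
case: p p_pr p_gt3 p_odd D3 => // p p_pr p_gt3 p_odd D3 D2.
rewrite /clausen_sum big_ord_recl big_ord_recr /= legendre_coef0 mulr1.
rewrite /bump add1n {1 3}/clausen_coef {2}/legendre_coef muln0 bin0 mul1r subn0.
rewrite subnn binn mul1n expr0 mulr1 addnn -mul2n ['C(_, _)%:R]natz.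
rewrite exprS exprN3_even //.
have DS : (p.+1%:Z %| \sum_(i < p)
    clausen_coef p.+1 (1 + i) * legendre_coef p.+1 (1 + i))%Z.
  apply: rpred_sum => i _.
  rewrite dvdz_mull // /legendre_coef PoszM dvdz_mulr //.
  by apply: prime_dvd_bin => //; have := ltn_ord i; lia.
move: DS D2 D3 => /=; move: (\sum_(i < p) _) 'C(2 * p.+1, p.+1)%:Z => S C.
move=> DS D2 D3.
rewrite [X in (_ %| X)%Z](_ : _ =
    -3 * (3 ^+ p - 1) + S + (C + 2) * (C - 2)); last by ring.
have {}D2 : (p.+1%:Z %| C - 2)%Z by apply: dvdz_trans D2; rewrite dvdz_exp.
by rewrite !rpredD ?dvdz_mull.
Qed.

(** In the expansion of T_(p-1)^2 only the term j = 0, equal to (-3)^(p-1), is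
    prime to p: u_j(p-1) is u_j(p) times (p - j) / (p + j). *)
Lemma central_trinomial_pred_prime_sqr_mod (p : nat) : prime p -> (3 < p)%N ->
  (p%:Z %| central_trinomial p.-1 ^+ 2 - 1)%Z.
Proof.
move=> p_pr p_gt3; have := central_trinomial_sqr p.-1 p.-1 (leqnn _).
rewrite subnn expr0 mul1r => ->.
have p_odd : odd p by case: (even_prime p_pr) p_gt3 => // ->.
have := dvdz_fermat p 3 p_pr; rewrite gtnNdvd // => /(_ isT).
case: p p_pr p_gt3 p_odd => // p p_pr p_gt3 p_odd /= D3.
rewrite /clausen_sum big_ord_recl /= legendre_coef0 mulr1.
rewrite {1}/clausen_coef muln0 bin0 mul1r subn0 exprN3_even // addrAC.
apply: rpredD => //; apply: rpred_sum => i _; rewrite dvdz_mull //.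
have ltip := ltn_ord i; rewrite /bump add1n.
have co_pi : coprimez p.+1 (p%:R + 1 + i.+1%:R).
  have -> : p%:R + 1 + i.+1%:R = (p.+1 + i.+1)%N%:Z by lia.
  by rewrite coprimezE /= prime_coprime // dvdn_addr // gtnNdvd.
rewrite -(Gauss_dvdzr _ co_pi) -legendre_coef_recl dvdz_mull //.
by rewrite /legendre_coef PoszM dvdz_mulr //; apply: prime_dvd_bin.
Qed.

(** * The congruence *)

Lemma Zloc_frac (p : nat) (n d : int) : d != 0 -> ~~ (p%:Z %| d)%Z ->
  n%:~R / d%:~R \in Zloc p.
Proof.
move=> d0; apply: contra => /dvdz_trans; apply.
have : numq (n%:~R / d%:~R) * d = n * denq (n%:~R / d%:~R).
  apply: (@intr_inj rat); rewrite !intrM numqE.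
  by rewrite -mulrA [_%:~R * d%:~R]mulrC mulrA divfK ?intr_eq0.
move: (n%:~R / d%:~R) => x E.
have co : coprimez (denq x) (numq x).
  by rewrite coprimez_sym coprimezE coprime_num_den.
by rewrite -(Gauss_dvdzr _ co) E dvdz_mull.
Qed.

(** Of the telescoped quartic form only the term -24 p^2 (T_p T_(p-1))^2
    survives modulo p^3; 24 times the sum with weight 2k+1 has to be subtracted
    from it. *)
Lemma sum_odd_cube_trinomial_mod (N : nat) (p := N.+1) : prime p -> (3 < p)%N ->
  (p%:Z ^+ 3 %| 32 * (\sum_(0 <= k < p)
      (2 * k%:R + 1) ^+ 3 * central_trinomial k ^+ 4 * 9 ^+ (N - k))
    + 24 * p%:Z ^+ 2 + 6 * p%:Z * 3 ^+ N * (1 + 3 ^+ p))%Z.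
Proof.
move=> p_pr p_gt3.
have p_odd : odd p by case: (even_prime p_pr) p_gt3 => // ->.
have E := central_trinomial_quartic_telescope N.
have D1 := central_trinomial_prime_sqr_mod p p_pr p_gt3.
have D2 := central_trinomial_pred_prime_sqr_mod p p_pr p_gt3.
have D3 := sum_odd_clausen_sum_sqr_mod N p_pr p_odd.
move: E D3; rewrite -/p /= in D2 *.
rewrite (exprS (- 3)) exprN3_even //.
have -> : \sum_(0 <= k < p) (2 * k%:R + 1) * clausen_sum N k ^+ 2 =
    \sum_(0 <= k < p) (2 * k%:R + 1) * (central_trinomial k ^+ 4 * 9 ^+ (N - k)).
  apply: eq_big_nat => k /andP[_ lekN].
  rewrite -central_trinomial_sqr // exprMn -!exprM mulnC exprM.
  by congr (_ * _); rewrite mulrC -exprM.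
set A := (X in X = _); set B := (X in 4 * X - _); set D := (X in 32 * X).
have -> : A = 32 * D + 24 * B.
  rewrite /A /B /D !mulr_sumr -big_split; apply: eq_bigr => k _ /=; ring.
clearbody B D; move: D1 D2 => {A}; rewrite (natz p) (exprS 3).
move: (central_trinomial p) (central_trinomial N) (3 ^+ N : int) p%:Z.
move=> x y h q /dvdzP[a Ea] /dvdzP[b Eb] E /dvdzP[c Ec]; apply/dvdzP.
exists (3 * q * (x ^+ 2 - 2 * x * y - 3 * y ^+ 2) ^+ 2
  + 8 * x * y * (x ^+ 2 + 3 * y ^+ 2) - 24 * (a * y ^+ 2 + b) - 6 * c).
transitivity ((32 * D + 24 * B) - 6 * (4 * B - q * (h * (1 - -3 * h)))
  + 24 * q ^+ 2); first by ring.
rewrite E Ec; transitivity (3 * q ^+ 4 * (x ^+ 2 - 2 * x * y - 3 * y ^+ 2) ^+ 2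
  + 8 * q ^+ 3 * x * y * (x ^+ 2 + 3 * y ^+ 2)
  - 24 * q ^+ 2 * ((x ^+ 2 - 1) * y ^+ 2 + (y ^+ 2 - 1)) - 6 * (c * q ^+ 3)).
  by ring.
by rewrite Ea Eb; ring.
Qed.

Theorem mainTheorem4 (p : nat) (p_prime : prime p) (p_ge5 : (5 <= p)%N) :
  congr_ppow p 3
    (\sum_(0 <= k < p)
       (2 * k%:R + 1) ^+ 3 * ((central_trinomial k)%:~R ^+ 4 / 9 ^+ k))
    (- (3 * p%:R / 4)
     + 3 * p%:R ^+ 2 / 4 * (fermat_quotient p 3 / 4 - 1)).
Proof.
have p_gt3 : (3 < p)%N by apply: leq_trans p_ge5.
have /dvdzP[h Eh] : (p%:Z %| 3 ^+ p.-1 - 1)%Z.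
  by apply: dvdz_fermat; rewrite ?gtnNdvd.
have Efq : p%:R * fermat_quotient p 3 = 3 ^+ p.-1 - 1 :> rat.
  by rewrite /fermat_quotient mulrC divfK // pnatr_eq0 -lt0n prime_gt0.
case: p p_prime p_ge5 p_gt3 Eh Efq => // N p_pr _ p_gt3 Eh Efq.
have /dvdzP[z Ez] := sum_odd_cube_trinomial_mod N p_pr p_gt3.
rewrite /= in Eh Efq; set p := N.+1 in p_pr p_gt3 Eh Efq Ez *.
set D := \sum_(0 <= k < p) _ in Ez.
have -> : \sum_(0 <= k < p)
    (2 * k%:R + 1) ^+ 3 * ((central_trinomial k)%:~R ^+ 4 / 9 ^+ k)
    = D%:~R / 9 ^+ N :> rat.
  rewrite /D rmorph_sum mulr_suml; apply: eq_big_nat => k /andP[_ lekN].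
  rewrite -[in RHS](subnK (lekN : (k <= N)%N)) exprD invfM addnK.
  rewrite !rmorphM !rmorphXn rmorphD rmorphM /= !rmorph_nat -!mulrA; congr (_ * _).
  by congr (_ * _); rewrite mulVKf // expf_neq0.
pose H : int := 3 ^+ N.
have EH : H = h * p%:Z + 1 by rewrite -Eh subrK.
have p_neq0 : p%:R != 0 :> rat by rewrite pnatr_eq0.
have -> : fermat_quotient p 3 = h%:~R.
  apply: (mulfI p_neq0); rewrite Efq mulrC.
  by rewrite -[RHS](rmorphM _ h p%:Z) -Eh rmorphB rmorphXn.
pose d : int := 32 * H ^+ 2.
have H_neq0 : H != 0 by rewrite expf_neq0.
(* The numerator is what is left of z p^3 - 24 p^2 - 6 p H (1 + 3 H) minus
   32 H^2 times the right-hand side, once H = 1 + h p is used to extract p^3. *)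
exists ((z + 24 * h * (H + 1) - 6 * h ^+ 2 * H)%:~R / d%:~R).
  apply: Zloc_frac; first by rewrite mulf_neq0 // expf_neq0.
  rewrite dvdzE !abszM !abszX !Euclid_dvdM // !Euclid_dvdX //=.
  by rewrite (Euclid_dvdX 2 5) // !gtnNdvd // (ltn_trans _ p_gt3).
have -> : 9 ^+ N = H%:~R ^+ 2 :> rat.
  by rewrite /H rmorphXn -exprM mulnC exprM.
have {}Ez : 32 * D = z * p%:Z ^+ 3 - 24 * p%:Z ^+ 2 - 6 * p%:Z * H * (1 + 3 * H).
  by rewrite -Ez (exprS 3) -/H; ring.
have -> : D%:~R = (32 * D)%:~R / 32 :> rat by field.
have -> : p%:R = p%:~R :> rat by [].
have Hq_neq0 : H%:~R != 0 :> rat by rewrite intr_eq0.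
rewrite {}Ez {}/d; clearbody H D; move: Hq_neq0; rewrite {}EH => Hq_neq0.
by field; move: Hq_neq0; rewrite rmorphD rmorphM.
Qed.
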